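(* Let $\mathbf X=(X_1,\dots,X_d)$ be a recursive max-linear (ML) model on a DAG $\mathcal D=(V,E)$, $V=\{1,\dots,d\}$, with weights $c_{ki}>0$ ($i\in V$, $k\in \mathrm{pa}(i)\cup\{i\}$) and noise variables $Z_1,\dots,Z_d$. Let $B=(b_{ij})_{d\times d}$ be the matrix with entries $$b_{ji}=\bigvee_{p\in P_{ji}} d_{ji}(p)\ \text{ for } j\in \mathrm{an}(i);\qquad b_{ii}=c_{ii};\qquad b_{ji}=0\ \text{ for } j\in V\setminus(\mathrm{an}(i)\cup\{i\}),$$ for $i\in V$. Then $$X_i=\bigvee_{j\in \mathrm{An}(i)} b_{ji}Z_j,\qquad i=1,\dots,d;$$ i.e., $B$ is the ML coefficient matrix of $\mathbf X$.
   Context: Let $\mathcal D=(V,E)$ be a directed acyclic graph (DAG) with $V=\{1,\dots,d\}$; write $k\to i$ if $(k,i)\in E$. For $i\in V$, $\mathrm{pa}(i)=\{k:(k,i)\in E\}$ are the parents of $i$, $\mathrm{an}(i)$ is the set of ancestors of $i$ (nodes $j$ with a directed path of length at least one from $j$ to $i$), and $\mathrm{An}(i)=\mathrm{an}(i)\cup\{i\}$. $P_{ji}$ is the set of directed paths from $j$ to $i$ (of length at least one). A recursive max-linear (ML) model on $\mathcal D$ is a random vector $\mathbf X=(X_1,\dots,X_d)$ defined recursively by $$X_i=\bigvee_{k\in \mathrm{pa}(i)} c_{ki}X_k\vee c_{ii}Z_i,\qquad i=1,\dots,d,$$ with independent non-negative random variables $Z_1,\dots,Z_d$ (noise variables) and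 positive weights $c_{ki}$ for $i\in V$, $k\in\mathrm{pa}(i)\cup\{i\}$. The weight of a path $p=[j=k_0\to k_1\to\dots\to k_n=i]$ is $d_{ji}(p)=c_{k_0,k_0}\prod_{l=0}^{n-1}c_{k_l,k_{l+1}}$. A matrix $B=(b_{ij})_{d\times d}$ with non-negative entries is called ML coefficient matrix of $\mathbf X$ if $X_i=\bigvee_{j=1}^d b_{ji}Z_j$ for $i=1,\dots,d$. Here $\vee$ denotes maximum, and a maximum over the empty set is $0$. *)

(* Defs.v *)
From HB Require Import structures.
From mathcomp Require Import all_boot all_order all_algebra.
From mathcomp Require Import all_classical all_reals all_analysis.

Set Implicit Arguments.
Unset Strict Implicit.
Unset Printing Implicit Defensive.
Import Order.TTheory GRing.Theory Num.Theory.
Local Open Scope classical_set_scope.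
Local Open Scope ring_scope.

Section Digraph.
Variables (d : nat) (E : rel 'I_d).

(* The path k_0 -> k_1 -> ... -> k_n, with n >= 1, is encoded by its starting
   node k_0 together with the sequence [:: k_1; ...; k_n]. *)
Definition dipaths (j i : 'I_d) : set (seq 'I_d) :=
  [set p | [/\ p <> [::], path E j p & last j p = i]].

Definition acyclic : Prop := forall i, dipaths i i = set0.

Definition pa (i : 'I_d) : {set 'I_d} := [set k | E k i]%SET.

Definition an (i : 'I_d) : {set 'I_d} := [set j | `[< dipaths j i !=set0 >]]%SET.

Definition An (i : 'I_d) : {set 'I_d} := (i |: an i)%SET.

Section Weights.
Variables (R : realType) (c : 'I_d -> 'I_d -> R).

Definition path_weight (j : 'I_d) (p : seq 'I_d) : R :=
  c j j * \prod_(l < size p) c (nth j (j :: p) l) (nth j (j :: p) l.+1).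

(* The index set of the maximum is a classical set: when [acyclic] holds it is
   finite (see [finite_dipaths]), so that this is the maximum of the weights of
   all directed paths from j to i. *)
Definition ml_matrix : 'M[R]_d := \matrix_(j, i)
  if j \in an i then \big[Num.max/0]_(p \in dipaths j i) path_weight j p
  else if j == i then c i i
  else 0.

End Weights.

Lemma dipaths_uniq (j i : 'I_d) (p : seq 'I_d) :
  acyclic -> dipaths j i p -> uniq (j :: p).
Proof.
move=> acE [_ + _]; elim: p j => [//|k p IHp] j /= /andP[Ejk pp].
have /= -> := IHp _ pp; rewrite andbT.
apply/negP => jkp; have : path E j (k :: p) by rewrite /= Ejk.
case/splitPr: jkp => p1 p2; rewrite -cat_rcons cat_path => /andP[pj _].
have : dipaths j j (rcons p1 j).
  by split; [case: p1 {pj} | exact: pj | rewrite last_rcons].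
by rewrite acE.
Qed.

Lemma finite_dipaths (j i : 'I_d) : acyclic -> finite_set (dipaths j i).
Proof.
move=> acE.
pose f (t : {n : 'I_d.+1 & n.-tuple 'I_d}) : seq 'I_d := tagged t.
apply: (@sub_finite_set _ _ (f @` [set: _])); last by apply: finite_image; exact: finite_finset.
move=> p /(dipaths_uniq acE)/= /andP[_ up].
have sp : (size p < d.+1)%N.
  by rewrite ltnS -[X in (_ <= X)%N]card_ord -(card_uniqP up) max_card.
by exists (Tagged (fun n : 'I_d.+1 => n.-tuple 'I_d)
  (in_tuple p : (Ordinal sp).-tuple 'I_d)).
Qed.

End Digraph.

Section MaxLinear.
Variables (disp : measure_display) (T : measurableType disp) (R : realType).
Variables (P : probability T R) (d : nat).

Definition mutually_independent (Z : 'I_d -> {RV P >-> R}) : Prop :=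
  forall (J : {set 'I_d}) (A : 'I_d -> set R),
    (forall j, measurable (A j)) ->
    P (\bigcap_(j in [set` J]) (Z j @^-1` A j)) =
    (\prod_(j in J) P (Z j @^-1` A j))%E.

Record recursive_ML_model (E : rel 'I_d) (c : 'I_d -> 'I_d -> R)
    (Z X : 'I_d -> {RV P >-> R}) : Prop := {
  ML_acyclic : acyclic E;
  ML_weight_gt0 : forall i k, k \in (i |: pa E i)%SET -> 0 < c k i;
  ML_noise_ge0 : forall i w, 0 <= Z i w;
  ML_noise_indep : mutually_independent Z;
  ML_recursion : forall i w,
    X i w = Num.max (\big[Num.max/0]_(k in pa E i) (c k i * X k w))
                    (c i i * Z i w) }.

Definition ML_coefficient_matrix (B : 'M[R]_d)
    (Z X : 'I_d -> {RV P >-> R}) : Prop :=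
  (forall j i, 0 <= B j i) /\
  (forall i w, X i w = \big[Num.max/0]_(j < d) (B j i * Z j w)).

End MaxLinear.

(* Main.v *)
Require Import Defs.
From mathcomp Require Import all_boot all_order all_algebra.
From mathcomp Require Import all_classical all_reals all_analysis.

(** Everything happens pointwise: at a fixed outcome, the noise [z] and the
    solution [x] are real vectors.  Unfolding the recursion for [x i] expresses
    it as a maximum over all directed paths ending at [i], the empty one
    included, of the weight of the path times the noise at its starting node;
    grouping the paths by starting node gives the terms [b_ji z_j].

    Maxima are compared through two facts, which avoids rearranging iterated
    maxima.  Each path contribution is a lower bound of [x i]
    ([path_weight_le]), because one step along an edge never exceeds the
    recursion.  Conversely, [x i] is [0] or is exactly the contribution of some
    path ([path_weight_attained]), because a finite maximum is attained, so one
    can walk back from [i] to a parent carrying the maximum; acyclicity makes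
    the walk stop.  It then remains to see that [ml_matrix] dominates every
    path weight ([path_weight_le_ml_matrix]), where acyclicity makes the
    maximum over paths finite and keeps the diagonal equal to [c i i], and that
    its entries are no larger than what the paths impose
    ([ml_matrix_mul_le]). *)

Set Implicit Arguments.
Unset Strict Implicit.
Unset Printing Implicit Defensive.
Import Order.TTheory GRing.Theory Num.Theory.
Local Open Scope ring_scope.

Lemma bigmax_attained (R : realType) (I : eqType) (r : seq I) (Q : pred I)
    (F : I -> R) (y := \big[Num.max/0]_(i <- r | Q i) F i) :
  y = 0 \/ exists2 i, Q i & y = F i.
Proof.
rewrite /y; elim/big_ind: _ => [|a b Ha Hb|i Qi]; first by left.
- by rewrite /Num.max; case: ifP.
- by right; exists i.
Qed.

(** The [\in] maximum runs over the support of [F] only; finiteness of [A]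
    matters because an infinite support would make it equal to [0]. *)
Lemma le_fsbigmax (R : realType) (I : choiceType) (A : set I) (F : I -> R)
    (i : I) :
  finite_set A -> A i -> F i <= \big[Num.max/0]_(k \in A) F k.
Proof.
move=> finA Ai; have [->|Fi0] := eqVneq (F i) 0; first exact: bigmax_ge_id.
apply: le_bigmax_seq => //; rewrite in_finite_support; last first.
  by apply: sub_finite_set finA => k [].
by rewrite inE; split=> //; exact/eqP.
Qed.

Lemma fsbigmax_attained (R : realType) (I : choiceType) (A : set I)
    (F : I -> R) (y := \big[Num.max/0]_(k \in A) F k) :
  y = 0 \/ exists2 i, A i & y = F i.
Proof.
pose s := finite_support 0 A F; rewrite /y big_seq -/s.
have [->|[i + ->]] := bigmax_attained s (fun k => k \in s) F; first by left.
rewrite /s; case: finite_supportP => // X XA _ _ iX.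
by right; exists i => //; exact: XA.
Qed.

Section Digraph.
Variables (d : nat) (E : rel 'I_d).

Lemma mem_an (j i : 'I_d) (p : seq 'I_d) :
  path E j p -> last j p = i -> p != [::] -> j \in an E i.
Proof. by move=> pp lp /eqP p0; rewrite inE; apply/asboolP; exists p. Qed.

Lemma an_irrefl (i : 'I_d) : acyclic E -> i \notin an E i.
Proof. by move=> acE; rewrite inE; apply/asboolPn; rewrite acE => -[]. Qed.

(** The number of ancestors strictly increases along edges: it serves as the
    rank for inductions over the graph. *)
Lemma card_an_lt (k i : 'I_d) :
  acyclic E -> E k i -> (#|an E k| < #|an E i|)%N.
Proof.
move=> acE Eki; apply/proper_card/properP; split; last first.
  exists k; last exact: an_irrefl.
  by apply: (@mem_an k i [:: i]) => //=; rewrite Eki.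
apply/fintype.subsetP => j; rewrite inE => /asboolP[p [p0 pp lp]].
apply: (@mem_an j i (rcons p i)); last by case: (p).
- by rewrite rcons_path pp lp.
- by rewrite last_rcons.
Qed.

Section Weights.
Variables (R : realType) (c : 'I_d -> 'I_d -> R).

Lemma path_weight_nil (j : 'I_d) : path_weight c j [::] = c j j.
Proof. by rewrite /path_weight big_ord0 mulr1. Qed.

Lemma path_weight_rcons (j k : 'I_d) (p : seq 'I_d) :
  path_weight c j (rcons p k) = path_weight c j p * c (last j p) k.
Proof.
rewrite /path_weight size_rcons big_ord_recr /= mulrA; congr (_ * _ * c _ _).
- by apply: eq_bigr => l _; rewrite -rcons_cons !nth_rcons /= ltnS ltnW // ltn_ord.
- by rewrite -rcons_cons nth_rcons ltnSn (last_nth j).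
- by rewrite nth_rcons ltnn eqxx.
Qed.

Lemma ml_matrix_ge0 (j i : 'I_d) : 0 <= c i i -> 0 <= ml_matrix E c j i.
Proof.
by move=> cii; rewrite mxE; case: ifP => _; [exact: bigmax_ge_id|case: ifP].
Qed.

Lemma path_weight_le_ml_matrix (j : 'I_d) (p : seq 'I_d) :
  acyclic E -> path E j p -> path_weight c j p <= ml_matrix E c j (last j p).
Proof.
move=> acE pp; have [->|p0] := eqVneq p [::].
  by rewrite path_weight_nil mxE /= (negbTE (an_irrefl j acE)) eqxx.
rewrite mxE (mem_an pp erefl p0); apply: le_fsbigmax.
- exact: finite_dipaths.
- by split=> //; exact/eqP.
Qed.

(** An entry of [ml_matrix] is [0] or the weight of a path, so a bound on all
    path contributions is a bound on [b_ji z_j]. *)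
Lemma ml_matrix_mul_le (j i : 'I_d) (z u : R) :
  0 <= u ->
  (forall p, path E j p -> last j p = i -> path_weight c j p * z <= u) ->
  ml_matrix E c j i * z <= u.
Proof.
move=> u0 leu; rewrite mxE; case: ifP => _.
  have [->|[p [_ pp lp] ->]] := fsbigmax_attained (dipaths E j i) (path_weight c j).
    by rewrite mul0r.
  exact: leu.
case: eqP => [ji|_]; last by rewrite mul0r.
by have := leu [::] isT ji; rewrite path_weight_nil ji.
Qed.

Definition max_linear_system (z x : 'I_d -> R) : Prop :=
  forall i, x i = Num.max (\big[Num.max/0]_(k in pa E i) (c k i * x k))
                          (c i i * z i).

Lemma max_linear_ge0 (z x : 'I_d -> R) (i : 'I_d) :
  max_linear_system z x -> 0 <= x i.
Proof. by move=> ->; rewrite le_max bigmax_ge_id. Qed.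

Lemma path_weight_le (z x : 'I_d -> R) (j : 'I_d) (p : seq 'I_d) :
  (forall k i, E k i -> 0 <= c k i) -> max_linear_system z x ->
  path E j p -> path_weight c j p * z j <= x (last j p).
Proof.
move=> c0 xE; elim/last_ind: p => [|p k IHp].
  by rewrite path_weight_nil /= (xE j) le_max lexx orbT.
rewrite rcons_path last_rcons path_weight_rcons => /andP[/IHp le_p Epk].
rewrite mulrAC (xE k) le_max; apply/orP; left.
apply: (@bigmax_sup _ _ _ _ (last j p)); first by rewrite inE.
by rewrite mulrC ler_wpM2l // c0.
Qed.

(** The recursion at [i] is attained at its own noise term, at a parent, or at
    the base value [0] of the maximum; in the second case a path attaining [x]
    at the parent is extended by one edge. *)
Lemma path_weight_attained (z x : 'I_d -> R) (i : 'I_d) :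
  acyclic E -> max_linear_system z x ->
  x i = 0 \/ exists j p,
    [/\ path E j p, last j p = i & x i = path_weight c j p * z j].
Proof.
move=> acE xE; have [n] := ubnP #|an E i|; elim: n i => // n IHn i.
rewrite ltnS => le_n.
have : x i = \big[Num.max/0]_(k in pa E i) (c k i * x k) \/ x i = c i i * z i.
  by rewrite {1 2}(xE i) /Num.max; case: ifP; [right|left].
case=> xi; last first.
  by right; exists i, [::]; split; rewrite // path_weight_nil.
move: xi; have [->|[k]] := bigmax_attained (index_enum _)
    (fun k => k \in pa E i) (fun k => c k i * x k); first by left.
rewrite inE => Eki -> xi.
have [xk0|[j [p [pp lp xk]]]] := IHn k (leq_trans (card_an_lt acE Eki) le_n).
  by left; rewrite xi xk0 mulr0.
right; exists j, (rcons p i); split; first by rewrite rcons_path pp lp.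
  by rewrite last_rcons.
by rewrite path_weight_rcons lp xi xk mulrCA mulrA.
Qed.

(** Ranging over any [Q] that contains [An i] covers at once the maximum over
    the ancestral set and the one over all nodes. *)
Lemma max_linear_solution (z x : 'I_d -> R) (Q : pred 'I_d) (i : 'I_d) :
  acyclic E -> (forall k i, E k i -> 0 <= c k i) -> (forall j, 0 <= z j) ->
  max_linear_system z x -> {subset An E i <= Q} ->
  x i = \big[Num.max/0]_(j | Q j) (ml_matrix E c j i * z j).
Proof.
move=> acE c0 z0 xE AnQ; apply/le_anti/andP; split.
  have [->|[j [p [pp lp ->]]]] := path_weight_attained i acE xE.
    exact: bigmax_ge_id.
  apply: (@bigmax_sup _ _ _ _ j).
    apply: AnQ; rewrite in_setU1; have [->|ji] := eqVneq j i => //=.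
    by apply: (mem_an pp lp); apply: contra_neq ji => p0; rewrite -lp p0.
  by rewrite ler_wpM2r // -lp path_weight_le_ml_matrix.
apply: bigmax_le => [|j _]; first exact: max_linear_ge0 xE.
apply: ml_matrix_mul_le => [|p pp <-]; first exact: max_linear_ge0 xE.
exact: path_weight_le.
Qed.

End Weights.
End Digraph.

Theorem theorem2p2 (disp : measure_display) (T : measurableType disp)
    (R : realType) (P : probability T R) (d : nat) (E : rel 'I_d)
    (c : 'I_d -> 'I_d -> R) (Z X : 'I_d -> {RV P >-> R})
    (hX : recursive_ML_model E c Z X) :
  (forall (i : 'I_d) (w : T),
     X i w = \big[Num.max/0]_(j in An E i) (ml_matrix E c j i * Z j w)) /\
  ML_coefficient_matrix (ml_matrix E c) Z X.
Proof.
case: hX => acE c_gt0 Z0 _ XE.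
have c0 k i : E k i -> 0 <= c k i.
  by move=> Eki; apply/ltW/c_gt0; rewrite !inE Eki orbT.
have sol w : max_linear_system E c (Z^~ w) (X^~ w) by move=> i; exact: XE.
split=> [i w|]; first exact: (max_linear_solution acE c0 (Z0^~ w) (sol w)).
split=> [j i|i w]; first by apply/ml_matrix_ge0/ltW/c_gt0; rewrite setU11.
exact: (max_linear_solution (Q := xpredT) acE c0 (Z0^~ w) (sol w)).
Qed.
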